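(* For all integers $n\ge0$, $$\hat{F}_{n+1}(y)=\sum_{k=0}^n \tilde{t}_{n,k}\,y^{2k-n}.$$
   Context: The Fibonacci polynomials $F_n(y)$, $n\ge 0$, are defined by the generating function $\sum_{n\ge 0}F_n(y)x^n = F(x,y)=\frac{x}{1-yx-x^2}$. The dual Fibonacci polynomials $\hat F_n(y)$, $n\ge 0$, are the polynomials defined by $\sum_{n\ge0}\hat F_n(y)x^n=u(x)$, where $u(x)$ is the compositional inverse (series reversion) of $F(x,y)$ with respect to $x$, i.e. the unique formal power series in $x$ with coefficients in $\mathbb{Q}[y]$ such that $u(0)=0$ and $\frac{u}{1-yu-u^2}=x$. The numbers $\tilde t_{n,k}$ ($n,k\ge0$) are the entries of the inversion of the Riordan array $(1,x(1+x))$: they are defined by $\sum_{n,k\ge0}\tilde t_{n,k}x^ny^k=\frac{v(x)}{x}$, where $v(x)$ is the unique formal power series in $x$ with coefficients in $\mathbb{Q}[y]$ such that $v(0)=0$ and $\frac{v}{1-yv-yv^2}=x$. The identity is one in $\mathbb{Q}[y,y^{-1}]$. *)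

(* Defs.v *)
From HB Require Import structures.
From mathcomp Require Import all_boot all_order all_algebra.
From mathcomp Require Import boolp classical_sets zify.
Set Implicit Arguments.
Unset Strict Implicit.
Unset Printing Implicit Defensive.
Import GRing.Theory.
Local Open Scope ring_scope.

(* Formal power series over R in one variable x: [f n] is the coefficient
   of x^n. *)
Record fps (R : Type) := Fps { fps_coef :> nat -> R }.

Lemma fpsP (R : Type) (f g : fps R) : f =1 g -> f = g.
Proof. by case: f g => [f] [g] /= /funext ->. Qed.

HB.instance Definition _ (R : Type) := gen_eqMixin (fps R).
HB.instance Definition _ (R : Type) := gen_choiceMixin (fps R).

Section FpsRing.
Variable R : comNzRingType.
Implicit Types f g h : fps R.

Definition fps0 : fps R := Fps (fun=> 0).
Definition fps_opp f := Fps (fun n => - f n).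
Definition fps_add f g := Fps (fun n => f n + g n).

Fact fps_addA : associative fps_add.
Proof. by move=> f g h; apply: fpsP => n /=; rewrite addrA. Qed.
Fact fps_addC : commutative fps_add.
Proof. by move=> f g; apply: fpsP => n /=; rewrite addrC. Qed.
Fact fps_add0 : left_id fps0 fps_add.
Proof. by move=> f; apply: fpsP => n /=; rewrite add0r. Qed.
Fact fps_addN : left_inverse fps0 fps_opp fps_add.
Proof. by move=> f; apply: fpsP => n /=; rewrite addNr. Qed.

HB.instance Definition _ :=
  GRing.isZmodule.Build (fps R) fps_addA fps_addC fps_add0 fps_addN.

Definition fpsC (c : R) : fps R := Fps (fun n => if n == 0%N then c else 0).
Definition fpsX : fps R := Fps (fun n => (n == 1%N)%:R).
Definition fps_mul f g :=
  Fps (fun n => \sum_(j < n.+1) f j * g (n - j)%N).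

Let tr n f : {poly R} := \poly_(i < n.+1) f i.

Let trE n f m : (m <= n)%N -> (tr n f)`_m = f m.
Proof. by move=> le_mn; rewrite coef_poly ltnS le_mn. Qed.

Let mul_trE n f g m : (m <= n)%N -> fps_mul f g m = (tr n f * tr n g)`_m.
Proof.
move=> le_mn; rewrite coefM /=; apply: eq_bigr => j _.
by rewrite !trE ?(leq_trans _ le_mn) ?leq_subr ?leq_ord //.
Qed.

Fact fps_mulC : commutative fps_mul.
Proof. by move=> f g; apply: fpsP => n; rewrite !(mul_trE _ _ (leqnn n)) mulrC. Qed.

Fact fps_mulA : associative fps_mul.
Proof.
move=> f g h; apply: fpsP => n.
transitivity ((tr n f * (tr n g * tr n h))`_n).
  rewrite coefM; apply: eq_bigr => j _.
  by rewrite trE ?leq_ord // (mul_trE _ _ (leq_subr j n)).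
rewrite mulrA coefM; apply: eq_bigr => j _.
by rewrite [in LHS]trE ?leq_subr // -(@mul_trE n) ?leq_ord //.
Qed.

Fact fps_mul1 : left_id (fpsC 1) fps_mul.
Proof.
move=> f; apply: fpsP => n; rewrite /= big_ord_recl /= mul1r subn0 big1 ?addr0 //.
by move=> i _; rewrite mul0r.
Qed.

Fact fps_mulDl : left_distributive fps_mul fps_add.
Proof.
move=> f g h; apply: fpsP => n; rewrite /= -big_split.
by apply: eq_bigr => i _; rewrite mulrDl.
Qed.

Fact fps_1neq0 : fpsC 1 != fps0.
Proof.
by apply/eqP => /(congr1 (fun f : fps R => f 0%N))/eqP; rewrite /= oner_eq0.
Qed.

HB.instance Definition _ := GRing.Zmodule_isComNzRing.Build (fps R)
  fps_mulA fps_mulC fps_mul1 fps_mulDl fps_1neq0.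

(* As usual in this hierarchy, the inverse of a non-invertible series is the
   series itself. *)
Definition fps_unit : pred (fps R) := fun f => `[< exists g, g * f = 1 >].
Definition fps_inv f := xget f [set g | g * f = 1].

Fact fps_mulVx : {in fps_unit, left_inverse 1 fps_inv *%R}.
Proof. by move=> f /asboolP fU; apply: (xgetPex f fU). Qed.
Fact fps_unitPl f g : g * f = 1 -> fps_unit f.
Proof. by move=> gf1; apply/asboolP; exists g. Qed.
Fact fps_inv_out : {in [predC fps_unit], fps_inv =1 id}.
Proof.
move=> f /negP nU; apply: xgetPN => g gf1; apply: nU; exact: fps_unitPl gf1.
Qed.

HB.instance Definition _ := GRing.ComNzRing_hasMulInverse.Build (fps R)
  fps_mulVx fps_unitPl fps_inv_out.

(* This is the substitution f(g(x)) only when [g 0 = 0]: then g^i has no term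
   of degree less than i, so that the truncation at i = n is harmless. *)
Definition fps_comp f g : fps R :=
  Fps (fun n => \sum_(i < n.+1) f i * (g ^+ i) n).

Definition is_reversion f g := g 0%N = 0 /\ fps_comp f g = fpsX.

(* The compositional inverse of f; see [reversionP] for existence and
   uniqueness. *)
Definition reversion f : fps R := xget 0 [set g | is_reversion f g].

End FpsRing.

Arguments fpsX {R}.

Section WellDefined.
Variable R : comUnitRingType.
Implicit Types f g h : fps R.

Lemma fps_coefD f g n : (f + g) n = f n + g n. Proof. by []. Qed.
Lemma fps_coefN f n : (- f) n = - f n. Proof. by []. Qed.
Lemma fps_coefB f g n : (f - g) n = f n - g n. Proof. by []. Qed.
Lemma fps_coefM f g n : (f * g) n = \sum_(j < n.+1) f j * g (n - j)%N.
Proof. by []. Qed.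
Lemma fps_coef1 n : (1 : fps R) n = (n == 0%N)%:R.
Proof. by rewrite /=; case: eqP. Qed.
Lemma fps_coefCM c f n : (fpsC c * f) n = c * f n.
Proof.
rewrite fps_coefM big_ord_recl /= subn0 big1 ?addr0 // => i _.
by rewrite mul0r.
Qed.
Lemma fps_coef0M f g : (f * g) 0%N = f 0%N * g 0%N.
Proof. by rewrite fps_coefM big_ord_recl big_ord0 addr0. Qed.
Lemma fps_coefXM f n : (fpsX * f) n = if n is m.+1 then f m else 0.
Proof.
case: n => [|n]; first by rewrite fps_coef0M mul0r.
rewrite fps_coefM 2!big_ord_recl /= mul0r add0r mul1r subSS subn0.
by rewrite big1 ?addr0 // => i _; rewrite mul0r.
Qed.

Definition fps_agree n f g := forall i, (i < n)%N -> f i = g i.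

Lemma fps_agreeD n f f' g g' : fps_agree n f f' -> fps_agree n g g' ->
  fps_agree n (f + g) (f' + g').
Proof. by move=> Ef Eg i lt_in; rewrite !fps_coefD Ef ?Eg. Qed.

Lemma fps_agreeN n f f' : fps_agree n f f' -> fps_agree n (- f) (- f').
Proof. by move=> Ef i lt_in; rewrite !fps_coefN Ef. Qed.

Lemma fps_agreeM n f f' g g' : fps_agree n f f' -> fps_agree n g g' ->
  fps_agree n (f * g) (f' * g').
Proof.
move=> Ef Eg i lt_in; rewrite !fps_coefM; apply: eq_bigr => j _.
by rewrite Ef ?Eg // (leq_trans _ lt_in) // ltnS ?leq_subr // -ltnS.
Qed.

Lemma fps_agreeXM n f f' :
  fps_agree n f f' -> fps_agree n.+1 (fpsX * f) (fpsX * f').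
Proof. by move=> Ef [|i] lt_in; rewrite !fps_coefXM // Ef. Qed.

Lemma fps_agreeM0 n f f' g g' :
    f 0%N = 0 -> f' 0%N = 0 -> g 0%N = 0 -> g' 0%N = 0 ->
    fps_agree n f f' -> fps_agree n g g' ->
  fps_agree n.+1 (f * g) (f' * g').
Proof.
move=> f0 f'0 g0 g'0 Ef Eg i lt_in; rewrite !fps_coefM.
apply: eq_bigr => -[[|j] /= lt_ji] _; first by rewrite f0 f'0 !mul0r.
have [->|ne_ji] := eqVneq j.+1 i; first by rewrite subnn g0 g'0 !mulr0.
have lt_j1i : (j.+1 < i)%N by rewrite ltn_neqAle ne_ji.
rewrite Ef ?Eg //; last exact: leq_trans lt_j1i _.
apply: leq_trans (_ : (i <= n)%N) => //.
by rewrite -subn_gt0 subKn ?(ltnW lt_j1i).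
Qed.

Lemma fps_fixpoint (Phi : fps R -> fps R) :
    (forall n f g, fps_agree n f g -> fps_agree n.+1 (Phi f) (Phi g)) ->
  exists! f, Phi f = f.
Proof.
move=> PhiS; pose U n := iter n Phi 0.
have UD n m : fps_agree n (U n) (U (n + m)%N).
  by elim: n => [//|n IHn]; rewrite addSn; apply: PhiS.
pose f := Fps (fun n => U n.+1 n).
have Uf n : fps_agree n (U n) f.
  by move=> i lt_in; rewrite -(subnKC lt_in) -(UD i.+1).
exists f; split=> [|g gP].
  apply: fpsP => n; rewrite -(Uf n.+1) //.
  by apply: (PhiS n) => // i lt_in; rewrite Uf.
suff fg n : fps_agree n f g by apply: fpsP => n; apply: (fg n.+1).
elim: n => [//|n IHn] i lt_in; rewrite -gP -(PhiS _ _ _ IHn) //.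
by rewrite -(Uf n.+1) //; apply: (PhiS n) => // j lt_jn; rewrite -Uf.
Qed.

Lemma fps_unitE f : (f \is a GRing.unit) = (f 0%N \is a GRing.unit).
Proof.
apply/idP/idP => [fU|f0U].
  have /(congr1 (fun h : fps R => h 0%N)) := mulVr fU.
  by rewrite fps_coef0M mulrC => f0V; apply/unitrPr; exists (f^-1 0%N).
pose c := fpsC (f 0%N)^-1.
have [e def_e] : exists e, e = c * f - 1 by eexists.
have e0 : e 0%N = 0 by rewrite def_e fps_coefB fps_coefCM mulVr // subrr.
have [|g [gP _]] := @fps_fixpoint (fun g => c - e * g).
  move=> n g h gh; apply: fps_agreeD => //; apply: fps_agreeN => i lt_in.
  rewrite !fps_coefM; apply: eq_bigr => -[[|j] /= lt_ji] _.
    by rewrite e0 !mul0r.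
  by congr (_ * _); apply: gh; lia.
have cU : c * fpsC (f 0%N) = 1.
  by apply: fpsP => -[|n]; rewrite fps_coefCM /= ?mulVr // mulr0.
have cfg : c * (f * g) = c.
  by rewrite mulrA -[c * f](subrK 1) -def_e mulrDl mul1r addrC -{1}gP subrK.
apply/unitrPr; exists g.
by rewrite -[LHS]mul1r -cU mulrAC cfg cU.
Qed.

Theorem reversionP f : f 0%N = 0 -> f 1%N \is a GRing.unit ->
  is_reversion f (reversion f) /\
  (forall g, is_reversion f g -> g = reversion f).
Proof.
move=> f0 f1U.
have [d def_d] : exists d, forall g, d g = g - fpsC (g 0%N) by eexists.
have d0 g : d g 0%N = 0 by rewrite def_d fps_coefB /= subrr.
have [Phi def_Phi] : exists Phi, forall g, Phi g = fpsC (f 1%N)^-1 *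
  (fpsX - (fps_comp f (d g) - fpsC (f 1%N) * d g)) by eexists.
have comp0 g : fps_comp f g 0%N = 0.
  by rewrite /= big_ord_recl big_ord0 f0 mul0r addr0.
have Phi0 g : Phi g 0%N = 0.
  by rewrite def_Phi fps_coefCM 2!fps_coefB comp0 fps_coefCM d0 mulr0 !subr0 mulr0.
have tail g n : (fps_comp f g - fpsC (f 1%N) * g) n.+1 =
    \sum_(j < n) f j.+2 * (g ^+ j.+2) n.+1.
  rewrite fps_coefB fps_coefCM /= 2!big_ord_recl /= f0 mul0r add0r expr1.
  by rewrite addrC addKr.
have PhiE g n : Phi g n.+1 =
    (f 1%N)^-1 * (fpsX n.+1 - \sum_(j < n) f j.+2 * (d g ^+ j.+2) n.+1).
  by rewrite def_Phi -tail -fps_coefB -fps_coefCM.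
have PhiS n g h : fps_agree n g h -> fps_agree n.+1 (Phi g) (Phi h).
  move=> gh [|i] lt_in; first by rewrite !Phi0.
  have dgh : fps_agree n (d g) (d h).
    move=> j lt_jn; rewrite 2!def_d 2!fps_coefB gh //= gh //.
    exact: leq_ltn_trans lt_jn.
  have dX0 k j : (d k ^+ j.+1) 0%N = 0 by rewrite exprS fps_coef0M d0 mul0r.
  have dX j : fps_agree n (d g ^+ j.+1) (d h ^+ j.+1).
    elim: j => [//|j IHj]; rewrite (exprS (d g) j.+1) (exprS (d h) j.+1).
    exact: fps_agreeM.
  rewrite (PhiE g) (PhiE h); do 3 apply: congr1.
  apply: eq_bigr => j _; apply: congr1; rewrite (exprS (d g) j.+1) (exprS (d h) j.+1).
  by apply: (@fps_agreeM0 n).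
have cU : fpsC (f 1%N) * fpsC (f 1%N)^-1 = 1.
  by apply: fpsP => -[|n]; rewrite fps_coefCM /= ?mulrV // mulr0.
have dE g : g 0%N = 0 -> d g = g.
  move=> g0; apply: fpsP => n; rewrite def_d fps_coefB g0 /=.
  by case: eqP; rewrite subr0.
have revE g : is_reversion f g <-> Phi g = g.
  split=> [[g0 fg]|gP].
    by rewrite def_Phi dE // fg opprB addrC subrK mulrA [fpsC _ * _]mulrC cU mul1r.
  have g0 : g 0%N = 0 by rewrite -gP Phi0.
  split=> //; move: gP; rewrite def_Phi dE // => /(congr1 ( *%R (fpsC (f 1%N)))).
  rewrite mulrA cU mul1r opprB addrCA -[RHS]addr0 => /addrI /eqP.
  by rewrite subr_eq0 => /eqP.
have [g [/revE gP gU]] := fps_fixpoint PhiS.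
have revP : is_reversion f (reversion f) by apply: xgetPex; exists g.
split=> [|h /revE hP]; first exact: revP.
by rewrite -(gU _ hP); apply/gU/revE.
Qed.

End WellDefined.

(* The series live in Q[y][[x]]: the polynomial variable 'X is y, the series
   variable fpsX is x. *)
Notation yvar := (fpsC ('X : {poly rat})).

Definition fibonacci_gf : fps {poly rat} :=
  fpsX / (1 - yvar * fpsX - fpsX ^+ 2).

Definition fibonacci n : {poly rat} := fibonacci_gf n.

Definition dual_fibonacci n : {poly rat} := reversion fibonacci_gf n.

Definition ttilde_eq (v : fps {poly rat}) :=
  v 0%N = 0 /\ v / (1 - yvar * v - yvar * v ^+ 2) = fpsX.

Definition ttilde_series : fps {poly rat} := xget 0 [set v | ttilde_eq v].

(* The coefficient of x^n in v(x)/x is that of x^(n+1) in v(x). *)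
Definition ttilde n k : rat := (ttilde_series n.+1)`_k.

Lemma fibonacci_gf_reversionP :
  is_reversion fibonacci_gf (reversion fibonacci_gf) /\
  (forall u, is_reversion fibonacci_gf u -> u = reversion fibonacci_gf).
Proof.
have [D defD] : exists D : fps {poly rat}, D = 1 - yvar * fpsX - fpsX ^+ 2.
  by eexists.
have D0 : D 0%N = 1.
  rewrite defD fps_coefB fps_coefB fps_coef1 expr2 fps_coefXM fps_coefCM.
  by rewrite mulr0 !subr0.
have DU : D \is a GRing.unit by rewrite fps_unitE D0 unitr1.
have DV0 : D^-1 0%N = 1.
  by have := fps_coef0M D^-1 D; rewrite mulVr // fps_coef1 D0 mulr1.
apply: reversionP; rewrite /fibonacci_gf -defD; first exact: fps_coefXM.
by rewrite fps_coefXM DV0 unitr1.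
Qed.

Lemma ttilde_seriesP :
  ttilde_eq ttilde_series /\ (forall v, ttilde_eq v -> v = ttilde_series).
Proof.
have [D defD] : exists D, forall v : fps {poly rat},
  D v = 1 - yvar * v - yvar * v ^+ 2 by eexists.
have DS n f g : fps_agree n f g -> fps_agree n (D f) (D g).
  move=> fg; rewrite !defD !expr2.
  by do 2?[apply: fps_agreeD; last apply: fps_agreeN] => //;
    do ?apply: fps_agreeM.
have [v [vP vU]] := fps_fixpoint (fun n f g fg => fps_agreeXM (DS n f g fg)).
have eqE w : ttilde_eq w <-> fpsX * D w = w.
  rewrite /ttilde_eq -defD; split=> [[w0 <-]|wP].
    rewrite divrK // fps_unitE defD fps_coefB fps_coefB fps_coef1.
    by rewrite 2!fps_coefCM expr2 fps_coef0M w0 !mulr0 !subr0 unitr1.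
  have w0 : w 0%N = 0 by rewrite -wP fps_coefXM.
  split=> //; rewrite -{1}wP mulrK // fps_unitE defD fps_coefB fps_coefB.
  by rewrite fps_coef1 2!fps_coefCM expr2 fps_coef0M w0 !mulr0 !subr0 unitr1.
have tP : ttilde_eq ttilde_series by apply: xgetPex; exists v; apply/eqE.
split=> // w /eqE wP; rewrite -(vU _ wP); exact/vU/eqE.
Qed.

(* Laurent polynomials, Q[y, y^-1], are viewed inside the field of rational
   functions Q(y) = {fraction {poly rat}}; the embedding tofrac of Q[y] is
   injective. *)
Notation "p %:F" := (tofrac p) : ring_scope.

(* Main.v *)
Require Import Defs.
From HB Require Import structures.
From mathcomp Require Import all_boot all_order all_algebra.
From mathcomp Require Import ring.
Set Implicit Arguments.
Unset Strict Implicit.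
Unset Printing Implicit Defensive.
Import GRing.Theory.
Local Open Scope ring_scope.

(** Let u be the reversion of F and v the series with v / (1 - y v - y v^2) = x.
    Clearing denominators, they are characterized by the functional equations
    u = x (1 - y u - u^2) and v = x (1 - y v - y v^2).  They are related by a
    change of variables: if v solves the second one, then
    w(x, y) = y v(x / y, y^2) solves the first one, because
      y v(x / y, y^2) = x (1 - y^2 v - y^2 v^2) = x (1 - y w - w^2).
    Comparing coefficients of x^(n+1) gives u_(n+1)(y) = y^(-n) v_(n+1)(y^2),
    and the identity follows because v_(n+1) has degree at most n in y.

    To stay inside Q[y][[x]], x is replaced by y x: both u(y x, y) and
    y v(x, y^2) satisfy
      f = x y (1 - y f - f^2),
    an equation with only one solution since it determines each coefficient
    from the previous ones ([rescaled_eq_uniq], [dual_fibonacci_ttilde]).  The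
    substitutions x := y x and y := y^2 are ring morphisms, given by
    [fps_dilate] and [fps_map], so they carry the equations for u and v
    to this one.

    The equation for u is obtained by substituting u in
    F = x (1 + y F + x F); what this takes is that substitution is linear and
    turns multiplication by x into multiplication by the inner series
    ([fps_comp_XM]). *)

(** * Ring morphisms between rings of power series *)

Section FpsMorphisms.
Variable R : comNzRingType.

(** The substitution x := c x. *)
Definition fps_dilate (c : R) (f : fps R) : fps R :=
  Fps (fun n => c ^+ n * f n).

Fact fps_dilate_is_zmod_morphism c : zmod_morphism (fps_dilate c).
Proof. by move=> f g; apply: fpsP => n; rewrite /= mulrBr. Qed.

Fact fps_dilate_is_monoid_morphism c : monoid_morphism (fps_dilate c).
Proof.
split=> [|f g]; apply: fpsP => n /=.
  by case: n => [|n]; rewrite ?mulr1 ?mulr0.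
rewrite mulr_sumr; apply: eq_bigr => j _.
by rewrite mulrACA -exprD subnKC // -ltnS.
Qed.

HB.instance Definition _ c :=
  GRing.isZmodMorphism.Build (fps R) (fps R) (fps_dilate c)
    (fps_dilate_is_zmod_morphism c).
HB.instance Definition _ c :=
  GRing.isMonoidMorphism.Build (fps R) (fps R) (fps_dilate c)
    (fps_dilate_is_monoid_morphism c).

Lemma fps_dilateC c a : fps_dilate c (fpsC a) = fpsC a.
Proof. by apply: fpsP => -[|n] /=; rewrite ?mul1r ?mulr0. Qed.

Variables (S : comNzRingType) (phi : {rmorphism R -> S}).

Definition fps_map (f : fps R) : fps S := Fps (fun n => phi (f n)).

Fact fps_map_is_zmod_morphism : zmod_morphism fps_map.
Proof. by move=> f g; apply: fpsP => n; rewrite /= rmorphB. Qed.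

Fact fps_map_is_monoid_morphism : monoid_morphism fps_map.
Proof.
split=> [|f g]; apply: fpsP => n /=.
  by case: n => [|n]; rewrite ?rmorph1 ?rmorph0.
by rewrite rmorph_sum; apply: eq_bigr => j _; rewrite rmorphM.
Qed.

HB.instance Definition _ :=
  GRing.isZmodMorphism.Build (fps R) (fps S) fps_map fps_map_is_zmod_morphism.
HB.instance Definition _ :=
  GRing.isMonoidMorphism.Build (fps R) (fps S) fps_map
    fps_map_is_monoid_morphism.

Lemma fps_mapC a : fps_map (fpsC a) = fpsC (phi a).
Proof. by apply: fpsP => -[|n] //=; rewrite rmorph0. Qed.

Lemma fps_mapX : fps_map fpsX = fpsX.
Proof. by apply: fpsP => n /=; rewrite rmorph_nat. Qed.

End FpsMorphisms.

Lemma fps_dilateX (R : comUnitRingType) (c : R) :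
  fps_dilate c fpsX = fpsC c * fpsX.
Proof.
by apply: fpsP => -[|[|n]]; rewrite fps_coefCM /= ?expr1 ?mulr0.
Qed.

Lemma fpsCM (R : comUnitRingType) (a b : R) : fpsC (a * b) = fpsC a * fpsC b.
Proof. by apply: fpsP => -[|n]; rewrite fps_coefCM //= mulr0. Qed.

(** * Composition of power series *)

Section Composition.
Variable R : comUnitRingType.
Implicit Types f g h : fps R.

Lemma fps_expr_small h i n : h 0%N = 0 -> (n < i)%N -> (h ^+ i) n = 0.
Proof.
move=> h0; elim: i n => [//|i IHi] n lt_ni.
rewrite exprS fps_coefM big1 // => -[[|j] /= lt_jn] _.
  by rewrite h0 mul0r.
rewrite IHi ?mulr0 // -ltnS; apply: leq_trans lt_ni.
by rewrite ltnS ltn_subrL (leq_trans _ (lt_jn : (j.+1 <= n)%N)).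
Qed.

(** A truncation order common to several coefficients makes it possible to
    exchange the sum over powers of h with the convolution of a product. *)
Lemma fps_comp_widen f h n N : h 0%N = 0 -> (n < N)%N ->
  fps_comp f h n = \sum_(i < N) f i * (h ^+ i) n.
Proof.
move=> h0 lt_nN; rewrite /= -!(big_mkord xpredT (fun i => f i * (h ^+ i) n)).
rewrite [RHS](big_cat_nat (n := n.+1)) //= [X in _ + X]big1_seq ?addr0 // => i.
rewrite mem_index_iota => /andP[_ /andP[lt_ni _]].
by rewrite fps_expr_small ?mulr0.
Qed.

Lemma fps_compD f g h : fps_comp (f + g) h = fps_comp f h + fps_comp g h.
Proof.
apply: fpsP => n; rewrite fps_coefD -big_split.
by apply: eq_bigr => i _; rewrite fps_coefD mulrDl.
Qed.

Lemma fps_compCM c f h : fps_comp (fpsC c * f) h = fpsC c * fps_comp f h.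
Proof.
apply: fpsP => n; rewrite fps_coefCM mulr_sumr.
by apply: eq_bigr => i _; rewrite fps_coefCM mulrA.
Qed.

Lemma fps_comp1 h : fps_comp 1 h = 1.
Proof.
apply: fpsP => n; rewrite [LHS]big_ord_recl expr0 mul1r big1 ?addr0 // => i _.
by rewrite fps_coef1 mul0r.
Qed.

Lemma fps_comp_XM f h : h 0%N = 0 -> fps_comp (fpsX * f) h = h * fps_comp f h.
Proof.
move=> h0; apply: fpsP => n.
(* One index beyond the definition, so that after shifting by x both sides sum
   over the same range; the extra power of h does not reach x^n. *)
rewrite (@fps_comp_widen _ _ n n.+2) // big_ord_recl fps_coefXM mul0r add0r.
rewrite fps_coefM; transitivity (\sum_(j < n.+1) \sum_(i < n.+1)
    f i * (h j * (h ^+ i) (n - j)%N)).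
  rewrite exchange_big; apply: eq_bigr => i _.
  by rewrite fps_coefXM exprS fps_coefM mulr_sumr.
apply: eq_bigr => j _.
rewrite (@fps_comp_widen _ _ _ n.+1) ?ltnS ?leq_subr // mulr_sumr.
by apply: eq_bigr => i _; rewrite mulrCA.
Qed.

End Composition.

(** * The two functional equations *)

Notation dual_fibonacci_gf := (reversion fibonacci_gf).

(** The quotient defining F in a division-free form, where substitution can be
    carried out termwise. *)
Lemma fibonacci_gf_eq :
  fibonacci_gf = fpsX * (1 + yvar * fibonacci_gf + fpsX * fibonacci_gf).
Proof.
have DU : 1 - yvar * fpsX - fpsX ^+ 2 \is a @GRing.unit (fps {poly rat}).
  rewrite fps_unitE 2!fps_coefB fps_coef1 fps_coefCM expr2 fps_coefXM mulr0.
  by rewrite !subr0 unitr1.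
have := divrK DU fpsX; rewrite -/fibonacci_gf => FD.
rewrite mulrDr mulrDr mulr1 -{1}FD; ring.
Qed.

Lemma dual_fibonacci_gf_eq : let u := dual_fibonacci_gf in
  u = fpsX * (1 - yvar * u - u ^+ 2).
Proof.
move=> u; have [[u0 Fu] _] := fibonacci_gf_reversionP; rewrite -/u in u0 Fu.
have := Fu; rewrite {1}fibonacci_gf_eq fps_comp_XM // 2!fps_compD fps_comp1.
rewrite fps_compCM Fu fps_comp_XM // Fu => xE.
(* The hypothesis reads x = u (1 + y x + u x); solve it for u. *)
transitivity (u * (1 + yvar * fpsX + u * fpsX) - u * (yvar * fpsX + u * fpsX)).
  ring.
rewrite xE; ring.
Qed.

Lemma ttilde_series_eq : let v := ttilde_series in
  v = fpsX * (1 - yvar * v - yvar * v ^+ 2).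
Proof.
move=> v; have [[v0 <-] _] := ttilde_seriesP; rewrite -/v in v0 *.
rewrite divrK // fps_unitE 2!fps_coefB fps_coef1 2!fps_coefCM expr2.
by rewrite fps_coef0M v0 !mulr0 !subr0 unitr1.
Qed.

(** * Comparison of the coefficients *)

(** Multiplication by x makes each coefficient of the right-hand side depend
    only on earlier coefficients of f. *)
Lemma rescaled_eq_uniq (f g : fps {poly rat}) :
  f = fpsX * (yvar * (1 - yvar * f - f ^+ 2)) ->
  g = fpsX * (yvar * (1 - yvar * g - g ^+ 2)) -> f = g.
Proof.
move=> fP gP.
have [|h [_ hU]] := @fps_fixpoint {poly rat}
  (fun f => fpsX * (yvar * (1 - yvar * f - f ^+ 2))).
  move=> n f1 f2 f12; apply: fps_agreeXM; rewrite !expr2.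
  apply: fps_agreeM => //.
  by do 2?[apply: fps_agreeD; last apply: fps_agreeN] => //;
    apply: fps_agreeM.
by rewrite -(hU f) // -(hU g).
Qed.

Lemma dual_fibonacci_ttilde :
  fps_dilate 'X dual_fibonacci_gf =
  yvar * fps_map (comp_poly 'X^2) ttilde_series.
Proof.
apply: rescaled_eq_uniq.
  rewrite {1}dual_fibonacci_gf_eq expr2 !(rmorphM, rmorphB) rmorph1 /=.
  by rewrite fps_dilateX fps_dilateC -expr2 -mulrA mulrCA.
have yE : fps_map (comp_poly 'X^2) yvar = yvar * yvar.
  by rewrite fps_mapC -fpsCM; congr fpsC; apply: comp_polyX.
rewrite {1}ttilde_series_eq (expr2 ttilde_series).
rewrite !(rmorphM, rmorphB) rmorph1 /=.
rewrite fps_mapX yE; ring.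
Qed.

Lemma dual_fibonacciS n :
  'X^n * dual_fibonacci n.+1 = ttilde_series n.+1 \Po 'X^2.
Proof.
apply: (mulfI (negbT (polyX_eq0 rat))).
have /(congr1 (fun f : fps {poly rat} => f n.+1)) := dual_fibonacci_ttilde.
by rewrite fps_coefCM /= exprS -mulrA.
Qed.

(** Induction on v_(n+1) = [n = 0] - y v_n - y (v^2)_n: the coefficients of v^2
    are sums of products v_j v_(n-j), which either vanish or have degree at most
    (j - 1) + (n - j - 1) = n - 2 in y.  Size rather than degree lets the bound
    include v_0 = 0. *)
Lemma size_ttilde_series n : (size (ttilde_series n) <= n)%N.
Proof.
elim/ltn_ind: n => -[|n] IHn.
  by rewrite ttilde_series_eq fps_coefXM size_poly0.
have sizeXM (p : {poly rat}) : (size p <= n)%N -> (size ('X * p)%R <= n.+1)%N.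
  by move=> le_pn; apply: leq_trans (size_polyMleq _ _) _; rewrite size_polyX.
rewrite ttilde_series_eq fps_coefXM 2!fps_coefB fps_coef1 2!fps_coefCM.
rewrite !(leq_trans (size_polyD _ _)) // geq_max size_polyN sizeXM ?andbT.
- rewrite (leq_trans (size_polyD _ _)) // geq_max size_polyN sizeXM ?IHn //.
  by case: n {IHn sizeXM} => [|n]; rewrite ?size_poly1 ?size_poly0.
- rewrite expr2 fps_coefM; apply: leq_trans (size_sum _ _ _) _.
  apply/bigmax_leqP => j _; apply: leq_trans (size_polyMleq _ _) _.
  have le_jn : (j <= n)%N by rewrite -ltnS.
  apply: leq_trans (leq_pred _) _; rewrite -[leqRHS](subnKC le_jn).
  by rewrite leq_add ?IHn ?ltnS ?leq_subr.
Qed.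

Theorem proposition5 (n : nat) :
  (dual_fibonacci n.+1)%:F =
  \sum_(k < n.+1) ((ttilde n k)%:P)%:F *
    (('X : {poly rat})%:F) ^ (2 * k%:Z - n%:Z)
  :> {fraction {poly rat}}.
Proof.
have X0 : ('X : {poly rat})%:F != 0 by rewrite tofrac_eq0 polyX_eq0.
apply: (mulfI (expf_neq0 n X0)).
rewrite -tofracXn -tofracM dual_fibonacciS.
rewrite /comp_poly (@horner_coef_wide _ n.+1); last first.
  by rewrite size_map_polyC size_ttilde_series.
rewrite rmorph_sum mulr_sumr; apply: eq_bigr => k _ /=.
rewrite coef_map -exprM tofracM !tofracXn mulrCA (exprnP _ n) -expfzDr //.
by rewrite addrC subrK -PoszM -exprnP.
Qed.
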